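(* Fix a multicharge $\mathbf{s}^l\in\mathbb{Z}^l[m]$. Let $\mathbf{s}_e=(s_0,\dots,s_{e-1})\in\mathbb{Z}^e[m]$ and $w\in\mathbb{Z}_{\ge 0}$ be such that $B(\mathbf{s}_e,w)$ is a block of an Ariki-Koike algebra $\mathcal{H}_n^{\mathbf{s}^l}$, and let $\mathcal{B}$ be the corresponding ordinary block (a set of $l$-partitions). Let $0\le i\le e-1$ and assume that $$s_i-s_{i-1}\ge w \quad\text{if } i\in\{1,\dots,e-1\},\qquad s_0-s_{e-1}\ge w+l\quad\text{if } i=0.$$ Then no $\boldsymbol{\mu}^l\in\mathcal{B}$ admits an addable $i$-node.
   Context: Fix integers $e\ge 2$, $l\ge 1$ and $m\in\mathbb{Z}$. For $r\ge1$, $\Pi^r$ is the set of $r$-partitions ($r$-tuples of partitions), $|\cdot|$ is total size, and $\mathbb{Z}^r[m]=\{(s_0,\dots,s_{r-1})\in\mathbb{Z}^r:\sum_{i=0}^{r-1}s_i=m\}$. A symbol of charge $m$ is a strictly increasing sequence of integers $(\beta_i)_{i<m}$ with $\beta_j=j$ for all sufficiently negative $j$, identified with the set of its entries. For a partition $\lambda=(\lambda_1\ge\lambda_2\ge\cdots)$ (with $\lambda_k=0$ for large $k$) put $X^m(\lambda)=\{\lambda_j-j+m: j\ge1\}$; this gives a bijection between partitions and symbols of charge $m$. A pair $(\boldsymbol{\lambda},\mathbf{s})\in\Pi^r\times\mathbb{Z}^r$ has $r$-symbol $(X^{s_0}(\lambda^0),\dots,X^{s_{r-1}}(\lambda^{r-1}))$;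 this is a bijection onto $r$-tuples of symbols. $\tau_e$: for a partition $\lambda$, put $Y^j=\{k\in\mathbb{Z}: j+ke\in X^m(\lambda)\}$ for $0\le j\le e-1$; $\tau_e(\lambda)\in\Pi^e\times\mathbb{Z}^e[m]$ is the pair whose $e$-symbol is $(Y^0,\dots,Y^{e-1})$. $\tau^l$: write each $\beta\in X^m(\lambda)$ uniquely as $\beta=c+ed+elq$ with $0\le c\le e-1$, $0\le d\le l-1$, $q\in\mathbb{Z}$, and let $X_d$ be the set of all $c+eq$ coming from the $\beta$ with this value of $d$; $\tau^l(\lambda)\in\Pi^l\times\mathbb{Z}^l[m]$ is the pair whose $l$-symbol is $(X_{l-1},X_{l-2},\dots,X_0)$. Both $\tau_e$ and $\tau^l$ are bijections from the set of partitions (for fixed $m$). Blocks: let $\boldsymbol{\lambda}^l\in\Pi^l$, $\mathbf{s}^l\in\mathbb{Z}^l[m]$ and $\tau_e\big((\tau^l)^{-1}(\boldsymbol{\lambda}^l,\mathbf{s}^l)\big)=(\boldsymbol{\lambda}_e,\mathbf{s}_e)$. Then $\mathbf{s}_e$ is the $e$-core multicharge of $(\boldsymbol{\lambda}^l,\mathbf{s}^l)$ and $|\boldsymbol{\lambda}_e|$ is its weight. The Ariki-Koike algebra $\mathcal{H}_n^{\mathbf{s}^l}$ is the cyclotomic Hecke algebra of $G(l,1,n)$ over $\mathbb{C}$ with parameters $\eta=\exp(2i\pi/e)$ and $\eta^{s_0},\dots,\eta^{s_{l-1}}$ for $\mathbf{s}^l=(s_0,\dots,s_{l-1})$. Its blocks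 induce a partition of $\{l\text{-partitions of } n\}$ into ordinary blocks, and these are parametrized by the $e$-core multicharge and the weight: the ordinary block $\mathcal{B}$ of $B(\mathbf{s}_e,w)$ is the set of all $l$-partitions $\boldsymbol{\mu}^l$ such that $(\boldsymbol{\mu}^l,\mathbf{s}^l)$ has $e$-core multicharge $\mathbf{s}_e$ and weight $w$ (all of these have the same size $n$). Addable nodes: the Young diagram of $\boldsymbol{\mu}^l=(\mu^0,\dots,\mu^{l-1})$ is $[\boldsymbol{\mu}^l]=\{(a,b,c): a\ge1,\ 0\le c\le l-1,\ 1\le b\le\mu^c_a\}$. Writing the $l$-multicharge as $\mathbf{s}^l=(t_0,\dots,t_{l-1})$, the residue of $(a,b,c)$ is $b-a+t_c$ modulo $e$. An addable $i$-node is a triple $\gamma=(a,b,c)\notin[\boldsymbol{\mu}^l]$, $a,b\ge1$, $0\le c\le l-1$, of residue $i\bmod e$, such that $[\boldsymbol{\mu}^l]\cup\{\gamma\}$ is the Young diagram of an $l$-partition. *)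

(* Defs.v *)
(* MathComp; sets of integers are the predicates [set int] of mathcomp.classical. *)
From HB Require Import structures.
From mathcomp Require Import all_boot all_order all_algebra.
From mathcomp Require Import classical_sets.

Set Implicit Arguments.
Unset Strict Implicit.
Unset Printing Implicit Defensive.

Import Order.TTheory GRing.Theory Num.Theory.
Local Open Scope classical_set_scope.
Local Open Scope ring_scope.

(* A partition is stored as the list of its nonzero parts, so that two
   partitions are equal exactly when their parts agree. *)
Record intpart : Type := IntPart {
  parts :> seq nat;
  _ : sorted geq parts && (0%N \notin parts) }.

HB.instance Definition _ := [isSub for parts].
HB.instance Definition _ := [Choice of intpart by <:].

(* The j-th part, with j counted from 1 and padding by zeros. *)
Definition part (lam : intpart) (j : nat) : nat := nth 0%N lam j.-1.

Definition multipart (r : nat) : Type := {ffun 'I_r -> intpart}.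

Definition msize (r : nat) (mu : multipart r) : nat :=
  (\sum_(c < r) sumn (mu c))%N.

Definition multicharge (r : nat) : Type := {ffun 'I_r -> int}.

Definition charges (r : nat) (m : int) : set (multicharge r) :=
  [set s | \sum_(c < r) s c = m].

Definition symbol (m : int) (lam : intpart) : set int :=
  [set beta | exists j : nat,
     (1 <= j)%N /\ beta = (part lam j)%:Z - j%:Z + m].

Definition msymbol (r : nat) (mu : multipart r) (s : multicharge r)
  (c : 'I_r) : set int := symbol (s c) (mu c).

(* Since (mu, s) |-> msymbol mu s is a bijection onto r-tuples of symbols, a
   pair is specified by its r-symbol; tau_e and tau^l are given by their
   graphs. *)
Definition is_tau_e (e : nat) (m : int) (lam : intpart)
    (mu : multipart e) (s : multicharge e) : Prop :=
  forall j : 'I_e,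
    msymbol mu s j = [set k : int | symbol m lam ((j : nat)%:Z + k * e%:Z)].

Definition tau_l_set (e l : nat) (m : int) (lam : intpart) (d : 'I_l) :
    set int :=
  [set x | exists (c : 'I_e) (q : int),
     symbol m lam ((c : nat)%:Z + e%:Z * (d : nat)%:Z + e%:Z * l%:Z * q) /\
     x = (c : nat)%:Z + e%:Z * q].

(* The l-symbol is (X_{l-1}, ..., X_0), hence the reversal of the index. *)
Definition is_tau_l (e l : nat) (m : int) (lam : intpart)
    (mu : multipart l) (s : multicharge l) : Prop :=
  forall c : 'I_l, msymbol mu s c = tau_l_set e m lam (rev_ord c).

(* (mu, t) has e-core multicharge s and weight w. *)
Definition has_core_weight (e l : nat) (m : int) (mu : multipart l)
    (t : multicharge l) (s : multicharge e) (w : nat) : Prop :=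
  exists (lam : intpart) (nu : multipart e),
    [/\ is_tau_l e m lam mu t, is_tau_e m lam nu s & msize nu = w].

Definition ordinary_block (e l : nat) (m : int) (t : multicharge l)
    (s : multicharge e) (w : nat) : set (multipart l) :=
  [set mu | has_core_weight m mu t s w].

(* The blocks of the Ariki-Koike algebra H_n^t are parametrized by the pairs
   (e-core multicharge, weight) of the l-partitions of n. *)
Definition is_AK_block (e l : nat) (m : int) (n : nat) (t : multicharge l)
    (s : multicharge e) (w : nat) : Prop :=
  exists mu : multipart l, msize mu = n /\ ordinary_block m t s w mu.

(* A node (a, b, c): row a, column b (both counted from 1), component c. *)
Definition node (l : nat) : Type := (nat * nat * 'I_l)%type.

Definition young (l : nat) (mu : multipart l) : set (node l) :=
  [set g : node l | let: (a, b, c) := g in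
     (1 <= a)%N /\ (1 <= b <= part (mu c) a)%N].

Definition content (l : nat) (t : multicharge l) (g : node l) : int :=
  let: (a, b, c) := g in b%:Z - a%:Z + t c.

Definition addable (e l : nat) (t : multicharge l) (mu : multipart l)
    (i : 'I_e) (g : node l) : Prop :=
  [/\ (1 <= g.1.1)%N /\ (1 <= g.1.2)%N,
      ~ young mu g,
      (content t g = (i : nat)%:Z %[mod e%:Z])%Z
    & exists nu : multipart l, young nu = young mu `|` [set g]].

(* Main.v *)
Require Import Defs.
From HB Require Import structures.
From mathcomp Require Import all_boot all_order all_algebra.
From mathcomp Require Import classical_sets.
From mathcomp Require Import zify.

Set Implicit Arguments.
Unset Strict Implicit.
Unset Printing Implicit Defensive.

Import Order.TTheory GRing.Theory Num.Theory.
Local Open Scope ring_scope.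

(** Call the entries of a symbol its beads and the other integers its gaps.
An addable node of content [x] in component [c] is a bead of the [c]-th
symbol at [x - 1] followed by a gap at [x] ([addable_symbol]). If [x] has
residue [i] modulo [e], pulling both positions back through [tau^l] and then
pushing them through [tau_e] yields a bead [k] of the component [i - 1] of the
[e]-symbol and a gap of its component [i], situated at [k] when [i > 0] and at
[k + l] when [i = 0]: in the latter case passing from [x - 1] to [x] adds
one to the quotient of the division by [e], which is a shift by [l] in the [e]-symbol
([addable_bead_gap]).

On the other hand a symbol of charge [s] of a partition [nu] has all its beads
below [s + |nu|] and all its gaps at or above [s - |nu|]. Since the components
[i - 1] and [i] are distinct, their two partitions have total size at most [w],
so the bead and the gap force [s_i - s_{i-1}] to be smaller than [w], resp.
[w + l] ([bead_gap_charge]). *)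

Lemma leq_part (lam : intpart) (j k : nat) :
  (j <= k)%N -> (part lam k <= part lam j)%N.
Proof.
move=> le_jk; rewrite /part.
have [szk|kz] := leqP (size lam) k.-1; first by rewrite nth_default.
case: lam kz => s /= /andP[s_sorted _] kz.
have geq_trans : transitive geq by move=> x y z yx xz; exact: leq_trans xz yx.
apply: (sorted_leq_nth geq_trans leqnn 0%N s_sorted); rewrite ?inE; lia.
Qed.

Lemma part_le_sumn (lam : intpart) (j : nat) : (part lam j <= sumn lam)%N.
Proof.
rewrite /part; have [szj|jz] := leqP (size lam) j.-1.
  by rewrite nth_default.
elim: (parts lam) (j.-1) jz => //= x s IHs [|k] /= ks; first exact: leq_addr.
exact: leq_trans (IHs k ks) (leq_addl _ _).
Qed.

Lemma size_le_sumn (lam : intpart) : (size lam <= sumn lam)%N.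
Proof.
case: lam => s /= /andP[_].
elim: s => //= x s IHs; rewrite inE negb_or => /andP[x0 /IHs]; lia.
Qed.

Lemma symbol_lt (s : int) (lam : intpart) (k : int) :
  symbol s lam k -> k < s + (sumn lam)%:Z.
Proof. by case=> j [j1 ->]; have := part_le_sumn lam j; lia. Qed.

(** Far enough down, every integer is the entry of an empty row. *)
Lemma symbolN_ge (s : int) (lam : intpart) (k : int) :
  ~ symbol s lam k -> s - (sumn lam)%:Z <= k.
Proof.
move=> Nk; rewrite leNgt; apply/negP => ltk; apply: Nk.
exists `|s - k|%N; split; first by lia.
rewrite /part nth_default; first by lia.
by have := size_le_sumn lam; lia.
Qed.

Lemma sumn_pair_le_msize (r : nat) (nu : multipart r) (a b : 'I_r) :
  a != b -> (sumn (nu a) + sumn (nu b) <= msize nu)%N.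
Proof.
move=> ab; rewrite /msize (bigD1 a) //= (bigD1 b) 1?eq_sym //=.
by rewrite leq_add2l leq_addr.
Qed.

Lemma bead_gap_charge (r : nat) (nu : multipart r) (s : multicharge r)
    (a b : 'I_r) (k h : int) :
  a != b -> msymbol nu s a k -> ~ msymbol nu s b h ->
  s b - s a < (msize nu)%:Z + (h - k).
Proof.
move=> ab /symbol_lt ka /symbolN_ge hb.
by have := sumn_pair_le_msize nu ab; lia.
Qed.

(** The bead at [content t g - 1] is the one of the row to which the node is added. The gap is free
because that row can grow: the rows above are strictly longer, so their beads
lie further up, and the rows below have smaller beads. *)
Lemma addable_symbol (e l : nat) (t : multicharge l) (mu : multipart l)
    (i : 'I_e) (g : node l) :
  addable t mu i g ->
  msymbol mu t g.2 (content t g - 1) /\ ~ msymbol mu t g.2 (content t g).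
Proof.
case: g => [[a b] c] [/= [a1 b1] Ng _ [nu youngE]].
have youngP j k : (1 <= j)%N -> (1 <= k)%N ->
    (k <= part (nu c) j)%N <-> (k <= part (mu c) j)%N \/ (j, k) = (a, b).
  move=> j1 k1.
  have : young nu (j, k, c) <-> young mu (j, k, c) \/ (j, k, c) = (a, b, c).
    by rewrite youngE.
  rewrite /young /= j1 k1 /= => -[nu_mu mu_nu].
  split=> [le_k|[le_k|[ja kb]]].
  - by have [//|[_]|[-> ->]] := nu_mu; [left|right].
  - by have [] := mu_nu (or_introl (conj isT le_k)).
  - by have [] := mu_nu; [right; rewrite ja kb|].
have nu_ab : (b <= part (nu c) a)%N by apply/youngP => //; right.
have mu_lt : (part (mu c) a < b)%N.
  by rewrite ltnNge; apply/negP => le_b; apply: Ng; rewrite a1 b1.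
have mu_a : b = (part (mu c) a).+1.
  have [b_le1|b_gt1] := leqP b 1; first by lia.
  have : (b.-1 <= part (nu c) a)%N by lia.
  case/youngP; [exact: a1|lia|lia|].
  by case; lia.
split; first by exists a; split=> //; lia.
case=> j [j1]; have [ja|aj] := ltnP j a.
  have : (b <= part (nu c) j)%N by apply: leq_trans nu_ab (leq_part _ (ltnW ja)).
  by case/youngP => // [|[]]; lia.
by have := leq_part (mu c) aj; lia.
Qed.

(** The component [c] of the [l]-symbol is the set [X_d] with
[d = l - 1 - c]; its entry [p + e q] corresponds to the bead
[p + e (d + l q)], that is to the entry [d + l q] of the component [p] of the
[e]-symbol. Passing from the residue [e - 1] to the residue [0] increases [q]
by one. *)
Lemma addable_bead_gap (e l : nat) (m : int) (lam : intpart)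
    (mu : multipart l) (t : multicharge l)
    (nu : multipart e) (s : multicharge e) (i : 'I_e) (g : node l) :
  is_tau_l e m lam mu t -> is_tau_e m lam nu s -> addable t mu i g ->
  exists k : int, msymbol nu s (ord_pred i) k /\
    ~ msymbol nu s i (k + (if (i : nat) == 0%N then l%:Z else 0)).
Proof.
move=> tau_l tau_e add_g; have [_ _ res_g _] := add_g.
have [] := addable_symbol add_g; rewrite tau_l.
move: (rev_ord g.2) (content t g) res_g => d x res_x.
case=> p [q [bead xE]] gap.
have i_p : i = ordS p.
  apply: val_inj => /=; have x_p : x = q * e%:Z + p.+1%:Z by lia.
  move: res_x; rewrite x_p modzMDl !modz_nat => -[].
  by rewrite (modn_small (ltn_ord i)) => ->.
exists ((d : nat)%:Z + l%:Z * q); rewrite i_p ordSK !tau_e /=; split.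
  by move: bead; congr (symbol m lam _); lia.
move=> gapN; apply: gap.
have [p_lt|p_ge] := ltnP p.+1 e.
  rewrite modn_small //= addr0 in gapN.
  exists (Ordinal p_lt), q; split=> /=; last by lia.
  by move: gapN; congr (symbol m lam _); lia.
have p_e : p.+1 = e by have := ltn_ord p; lia.
rewrite p_e modnn /= in gapN.
exists (ordS p), (q + 1); rewrite /= p_e modnn; split; last by lia.
by move: gapN; congr (symbol m lam _); lia.
Qed.

(* ord_pred i is i - 1 if i > 0, and e - 1 if i = 0. *)
Theorem proposition5p1 (e l : nat) (he : (2 <= e)%N) (hl : (1 <= l)%N) (m : int)
    (sl : multicharge l) (hsl : charges m sl)
    (se : multicharge e) (hse : charges m se) (w n : nat)
    (hblock : is_AK_block m n sl se w)
    (i : 'I_e)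
    (hpos : (0 < i)%N -> w%:Z <= se i - se (ord_pred i))
    (hzero : (i : nat) = 0%N -> w%:Z + l%:Z <= se i - se (ord_pred i)) :
  forall mu : multipart l, ordinary_block m sl se w mu ->
    ~ (exists g : node l, addable sl mu i g).
Proof.
move=> mu [lam [nu [tau_l tau_e nu_w]]] [g add_g].
have [k [bead gap]] := addable_bead_gap tau_l tau_e add_g.
have pred_neq : ord_pred i != i.
  have i_lt := ltn_ord i; apply/eqP => /(congr1 val) /=.
  have [->|i0] := posnP i; first by rewrite modn_small; lia.
  have -> : (i + e).-1 = (i.-1 + e)%N by lia.
  by rewrite modnDr modn_small; lia.
have := bead_gap_charge pred_neq bead gap; rewrite nu_w.
by case: eqP => [/hzero|/eqP]; [lia | rewrite -lt0n => /hpos; lia].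
Qed.
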